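(* Let $F_5$ be the $3$-graph on vertex set $\{1,2,3,4,5\}$ with $3$-edges $123, 124, 345$. For every integer $n\ge 6$, $$\mathrm{co^+ex}(n,F_5)=\left\lfloor\frac n3\right\rfloor .$$
   Context: A $3$-graph is a finite $3$-uniform hypergraph; an edge is written as the concatenation of its vertices. The minimum positive co-degree $\delta_2^+(H)$ of a non-empty $3$-graph $H$ is the maximum $k$ such that every pair of vertices contained in some edge of $H$ is contained in at least $k$ distinct edges of $H$. A hypergraph is $F$-free if it has no (not necessarily induced) subhypergraph isomorphic to $F$. $\mathrm{co^+ex}(n,F)$ is the maximum of $\delta_2^+(H)$ over all non-empty $n$-vertex $F$-free $3$-graphs $H$. *)

(* Defs.v *)
From HB Require Import structures.
From mathcomp Require Import all_boot.

Set Implicit Arguments.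
Unset Strict Implicit.
Unset Printing Implicit Defensive.

Record three_graph (V : finType) := ThreeGraph {
  edges : {set {set V}};
  edges_card3 : [forall e in edges, #|e| == 3] }.

HB.instance Definition _ (V : finType) := [isSub for @edges V].
HB.instance Definition _ (V : finType) := [Finite of three_graph V by <:].

Section Definitions.
Variables U V : finType.
Implicit Types (F : three_graph U) (H : three_graph V).

Definition codegree H (p : {set V}) : nat :=
  #|[set e in edges H | p \subset e]|.

Definition positive_pair H (p : {set V}) : bool :=
  (#|p| == 2) && [exists e in edges H, p \subset e].

(* Every codegree is at most #|edges H|, so when H is non-empty the range of k
   excludes no admissible value. *)
Definition min_pos_codegree H : nat :=
  \max_(k < #|edges H|.+1
        | [forall p : {set V}, positive_pair H p ==> (k <= codegree H p)]) k.

Definition contains F H : bool :=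
  [exists f : {ffun U -> V},
     injectiveb f && [forall e in edges F, f @: e \in edges H]].

End Definitions.

(* The n-vertex 3-graphs are taken on the vertex set 'I_n.  The maximum is 0 by
   convention if no 3-graph is admissible. *)
Definition co_pos_ex (U : finType) (n : nat) (F : three_graph U) : nat :=
  \max_(H : three_graph 'I_n | (edges H != set0) && ~~ contains F H)
    min_pos_codegree H.

(* The vertex i of 'I_5 stands for the vertex i + 1 of {1, 2, 3, 4, 5}. *)
Definition F5_edges : {set {set 'I_5}} :=
  let v i : 'I_5 := inord i.-1 in
  [set [set v 1; v 2; v 3]; [set v 1; v 2; v 4]; [set v 3; v 4; v 5]].

Lemma F5_edges_card3 : [forall e in F5_edges, #|e| == 3].
Proof.
apply/forall_inP => e; rewrite !inE => /orP[/orP[]|] /eqP->;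
  by rewrite setUC cardsU1 cards2 !inE -!val_eqE /= !inordK.
Qed.

Definition F5 : three_graph 'I_5 := ThreeGraph F5_edges_card3.

(* Main.v *)
(* In an F_5-free 3-graph of minimum positive co-degree at least 3, two edges
   abc, abd force the pair cd to be uncovered: otherwise cd would lie in an edge
   avoiding a and b, giving F_5.  If moreover the co-degree exceeds n/3, two of
   the three link neighbourhoods of the pairs of an edge abc meet, say abd and
   acd are edges, and then cd is covered, a contradiction.  The balanced complete
   tripartite 3-graph attains n/3. *)
Require Import Defs.
From mathcomp Require Import all_boot zify.

Set Implicit Arguments.
Unset Strict Implicit.
Unset Printing Implicit Defensive.

Lemma cards3_uniq (T : finType) (x y z : T) :
  (#|[set x; y; z]| == 3) = uniq [:: x; y; z].
Proof.
rewrite setUC cardsU1 cards2 !inE /= !inE (eq_sym z x) (eq_sym z y).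
by case: (x == y); case: (x == z); case: (y == z).
Qed.

Lemma cards3_exists (T : finType) (e : {set T}) :
  #|e| = 3 -> exists x y z, e = [set x; y; z].
Proof.
move=> e3; have [x xe] : exists x, x \in e by apply/card_gt0P; rewrite e3.
have /cards2P[y [z [_ eD]]] : #|e :\ x| == 2.
  (* Writing the added 1 as the truth value of [x \in e] gives the left side the shape of
     [cardsD1]. *)
  by rewrite -(eqn_add2l 1) -{1}[1]/(nat_of_bool true) -xe -cardsD1 e3.
by exists x, y, z; rewrite -setUA -eD setD1K.
Qed.

Lemma imset_set3 (aT rT : finType) (f : aT -> rT) (x y z : aT) :
  f @: [set x; y; z] = [set f x; f y; f z].
Proof. by rewrite !imsetU !imset_set1. Qed.

Section ThreeGraphs.
Variable V : finType.
Implicit Types (H : three_graph V) (x y z : V).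

(** Distinctness of the three vertices is not a separate clause: 3-uniformity forces it. *)
Definition adj H x y z := [set x; y; z] \in edges H.

Lemma adj_uniq H x y z : adj H x y z -> uniq [:: x; y; z].
Proof. by rewrite -cards3_uniq => Hxyz; apply: (forall_inP (edges_card3 H)). Qed.

Lemma adjCA H x y z : adj H x y z = adj H y x z.
Proof. by rewrite /adj [[set x; y]]setUC. Qed.

Lemma adjAC H x y z : adj H x y z = adj H x z y.
Proof. by rewrite /adj setUAC. Qed.

(** The map from [z] to [[set x; y; z]] is a bijection from third vertices to edges through the
    pair: [z] is recovered as the vertex outside [[set x; y]]. *)
Lemma codegree_adj H x y : x != y ->
  codegree H [set x; y] = #|[set z | adj H x y z]|.
Proof.
move=> xy; rewrite -(card_in_imset (f := fun z => [set x; y; z])).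
  congr #|pred_of_set _|; apply/setP => e; rewrite inE; apply/andP/imsetP.
    move=> [eH xye]; have e3 := eqP (forall_inP (edges_card3 H) e eH).
    have /cards1P[z ez] : #|e :\: [set x; y]| == 1.
      by rewrite cardsD (setIidPr xye) e3 cards2 xy.
    have eE : e = [set x; y; z] by rewrite -ez -{1}(setIidPr xye) setID.
    by exists z; rewrite // inE /adj -eE.
  by move=> [z]; rewrite inE => xyz ->; rewrite subsetUl; split.
move=> z t; rewrite !inE => /adj_uniq /=; rewrite !inE !andbT.
move=> /andP[/norP[_ xz] yz] _ /setP/(_ z); rewrite !inE eqxx orbT.
by rewrite ![z == _]eq_sym (negPf xz) (negPf yz) => /esym/eqP.
Qed.

Lemma adj_positive_pair H x y z : adj H x y z -> positive_pair H [set x; y].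
Proof.
move=> xyz; have /= := adj_uniq xyz; rewrite !inE => /andP[/norP[xy _] _].
rewrite /positive_pair cards2 xy; apply/exists_inP.
by exists [set x; y; z]; rewrite ?subsetUl.
Qed.

Lemma positive_pairP H (p : {set V}) :
  positive_pair H p -> exists x y z, p = [set x; y] /\ adj H x y z.
Proof.
move=> /andP[/cards2P[x [y [xy ->]]] /exists_inP[e eH xye]].
have : 0 < codegree H [set x; y] by apply/card_gt0P; exists e; rewrite inE eH.
rewrite codegree_adj // => /card_gt0P[z]; rewrite inE => xyz.
by exists x, y, z.
Qed.

(** Replaces the bounded maximum by a condition on links, which serves both the upper and the lower
    bound. *)
Lemma min_pos_codegree_leP H m : edges H != set0 ->
  reflect (forall x y z, adj H x y z -> m <= #|[set t | adj H x y t]|)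
          (m <= min_pos_codegree H).
Proof.
move=> H0; apply: (iffP idP) => [mH x y z xyz | mH].
  apply: leq_trans mH _; apply/bigmax_leqP => k /forallP/(_ [set x; y]).
  rewrite (adj_positive_pair xyz) codegree_adj //.
  by have /= := adj_uniq xyz; rewrite !inE => /andP[/norP[]].
have [e eH] := set0Pn _ H0.
have [a [b [c eE]]] := cards3_exists (eqP (forall_inP (edges_card3 H) e eH)).
have mcodeg x y z : adj H x y z -> m <= codegree H [set x; y].
  move=> xyz; rewrite codegree_adj; first exact: mH xyz.
  by have /= := adj_uniq xyz; rewrite !inE => /andP[/norP[]].
(* [m] must lie in the index range of the maximum. One edge suffices: [m] is at most the codegree of
   a pair in it, hence at most the number of edges. *)
have m_lt : m < #|edges H|.+1.
  rewrite ltnS; apply: (leq_trans (mcodeg a b c _)); first by rewrite /adj -eE.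
  by apply/subset_leq_card/subsetP => ?; rewrite inE => /andP[].
apply: (leq_bigmax_cond (Ordinal m_lt)); apply/forallP => p; apply/implyP.
by move=> /positive_pairP[x [y [z [-> /mcodeg]]]].
Qed.

Lemma contains_F5P H :
  reflect (exists a b c d e, [/\ uniq [:: a; b; c; d; e],
             adj H a b c, adj H a b d & adj H c d e])
          (contains F5 H).
Proof.
have forall_F5 (P : pred {set 'I_5}) : [forall e in edges F5, P e] =
    [&& P [set inord 0; inord 1; inord 2], P [set inord 0; inord 1; inord 3]
      & P [set inord 2; inord 3; inord 4]].
  apply/forall_inP/and3P => [PF | [P1 P2 P3] e].
    by split; apply: PF; rewrite !inE eqxx ?orbT.
  by rewrite !inE => /orP[/orP[]|] /eqP ->.
apply: (iffP existsP) => [[f /andP[/injectiveP f_inj]] | ].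
  rewrite forall_F5 !imset_set3 => /and3P[*].
  exists (f (inord 0)), (f (inord 1)), (f (inord 2)), (f (inord 3)).
  exists (f (inord 4)); split=> //.
  rewrite -[X in uniq X]/(map f [:: inord 0; inord 1; inord 2; inord 3; inord 4]).
  by rewrite map_inj_uniq //= !inE -!val_eqE /= !inordK.
move=> [a [b [c [d [e [abcde abc abd cde]]]]]].
(* The default [a] of [nth] is never reached, as [i < 5]. *)
pose f := [ffun i : 'I_5 => nth a [:: a; b; c; d; e] i].
exists f; rewrite forall_F5 !imset_set3 !ffunE !inordK //=; apply/and4P; split=> //.
apply/injectiveP => i j; rewrite !ffunE => /eqP.
by rewrite nth_uniq // => /eqP/val_inj.
Qed.

Lemma F5_free_uncovered H a b c d e : ~~ contains F5 H ->
  3 <= min_pos_codegree H -> adj H a b c -> adj H a b d -> ~~ adj H c d e.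
Proof.
move=> F5free H3 abc abd; apply/negP => cde; case/negP: F5free.
have H0 : edges H != set0 by apply/set0Pn; exists [set a; b; c].
(* The given [e] may be [a] or [b]; codegree at least 3 provides another third vertex [t] that is
   neither. *)
have : 0 < #|[set t | adj H c d t] :\: [set a; b]|.
  have := min_pos_codegree_leP _ H0 H3 _ _ _ cde.
  rewrite cardsD; have := subset_leq_card (subsetIr [set t | adj H c d t] [set a; b]).
  by rewrite cards2; case: (a != b) => /=; lia.
move=> /card_gt0P[t]; rewrite !inE => /andP[/norP[ta tb] cdt].
apply/contains_F5P; exists a, b, c, d, t; split=> //.
move: (adj_uniq abc) (adj_uniq abd) (adj_uniq cdt) => /=; rewrite !inE !negb_or.
rewrite ![t == _]eq_sym in ta tb.
by do ![move=> /andP[] | move=> /andP[/andP[]] | move=> ?]; rewrite ta tb; do ![apply/andP; split].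
Qed.

Lemma F5_free_min_pos_codegree H : 6 <= #|V| -> edges H != set0 ->
  ~~ contains F5 H -> min_pos_codegree H <= #|V| %/ 3.
Proof.
move=> V6 H0 F5free; rewrite leqNgt; apply/negP => lt_H.
(* Here [6 <= #|V|] enters: exceeding a quotient that is at least 2 means being at least 3. *)
have H3 : 3 <= min_pos_codegree H by lia.
have V_lt : #|V| < 3 * min_pos_codegree H by lia.
have disj a b c : adj H a b c ->
    #|[set t | adj H a b t] :&: [set t | adj H a c t]| = 0.
  move=> abc; apply/eqP; rewrite cards_eq0; apply/set0Pn => -[t].
  rewrite !inE => /andP[abt act].
  have /negP := F5_free_uncovered a F5free H3 abc abt; apply.
  by rewrite adjAC adjCA.
have /set0Pn[e eH] := H0.
have [a [b [c eE]]] := cards3_exists (eqP (forall_inP (edges_card3 H) e eH)).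
have abc : adj H a b c by rewrite /adj -eE.
have acb : adj H a c b by rewrite adjAC.
have bca : adj H b c a by rewrite adjAC adjCA.
have deg := min_pos_codegree_leP _ H0 (leqnn _).
have := max_card (mem ([set t | adj H a b t] :|: [set t | adj H a c t]
                        :|: [set t | adj H b c t])).
(* Inclusion-exclusion. Once the pairwise intersections are 0, truncated subtraction also makes the
   triple term vanish, so three sets of total size above [#|V|] would fit in [V]. *)
rewrite !cardsU setIUl cardsU disj //.
(* [disj] expects the shared vertex first in both pairs, hence the swaps here and below. *)
have -> : #|[set t | adj H a b t] :&: [set t | adj H b c t]| = 0.
  have -> : [set t | adj H a b t] = [set t | adj H b a t].
    by apply/setP => t; rewrite !inE adjCA.
  by apply: disj; rewrite adjCA.
have -> : #|[set t | adj H a c t] :&: [set t | adj H b c t]| = 0.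
  have -> : [set t | adj H a c t] = [set t | adj H c a t].
    by apply/setP => t; rewrite !inE adjCA.
  have -> : [set t | adj H b c t] = [set t | adj H c b t].
    by apply/setP => t; rewrite !inE adjCA.
  by apply: disj; rewrite adjCA.
have := deg _ _ _ abc; have := deg _ _ _ acb; have := deg _ _ _ bca; lia.
Qed.

Section Tripartite.
Variable col : V -> 'I_3.

(** The parts are the fibres of [col]; balance comes only with the choice of [residue3]. *)
Definition tripartite_edges : {set {set V}} :=
  [set e : {set V} | (#|e| == 3) && (#|col @: e| == 3)].

Lemma tripartite_edges_card3 : [forall e in tripartite_edges, #|e| == 3].
Proof. by apply/forall_inP => e; rewrite inE => /andP[]. Qed.

Definition tripartite : three_graph V := ThreeGraph tripartite_edges_card3.

Lemma tripartite_adj x y z :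
  adj tripartite x y z = uniq [:: col x; col y; col z].
Proof.
rewrite /adj inE imset_set3 !cards3_uniq; apply: andb_idl.
exact: (@map_uniq _ _ col [:: x; y; z]).
Qed.

Lemma ord3_uniq_inj (i j k l : 'I_3) :
  uniq [:: i; j; k] -> uniq [:: i; j; l] -> k = l.
Proof.
rewrite /= !inE -!val_eqE /= => ijk ijl; apply: val_inj => /=; move: ijk ijl.
by move: (ltn_ord i) (ltn_ord j) (ltn_ord k) (ltn_ord l); lia.
Qed.

(** Edges [abc] and [abd] give [c] and [d] the same colour, so no edge contains both. *)
Lemma tripartite_F5_free : ~~ contains F5 tripartite.
Proof.
apply/contains_F5P => -[a [b [c [d [e [_]]]]]]; rewrite !tripartite_adj.
by move=> /ord3_uniq_inj/[apply] ->; rewrite /= !inE eqxx.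
Qed.

(** The link of the pair [x], [y] contains the whole colour class of [z]. *)
Lemma tripartite_min_pos_codegree m : edges tripartite != set0 ->
  (forall i, m <= #|col @^-1: [set i]|) -> m <= min_pos_codegree tripartite.
Proof.
move=> T0 col_m; apply/min_pos_codegree_leP => // x y z xyz.
apply: leq_trans (col_m (col z)) _; apply/subset_leq_card/subsetP => t.
by rewrite !inE tripartite_adj => /eqP ->; rewrite -tripartite_adj.
Qed.

End Tripartite.
End ThreeGraphs.

Definition residue3 n (i : 'I_n) : 'I_3 := inord (i %% 3).

(** The numbers [3 * j + r] with [j < n %/ 3] are distinct, below [n] and of residue [r]. *)
Lemma card_residue3 n (r : 'I_3) : n %/ 3 <= #|@residue3 n @^-1: [set r]|.
Proof.
have lt_n (j : 'I_(n %/ 3)) : 3 * j + r < n.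
  by move: (ltn_ord j) (ltn_ord r); lia.
pose g j := Ordinal (lt_n j).
have g_inj : injective g by move=> i j [] ?; apply: val_inj => /=; lia.
rewrite -[n %/ 3]card_ord -cardsT -(card_imset _ g_inj).
apply/subset_leq_card/subsetP => _ /imsetP[j _ ->]; rewrite !inE.
by rewrite -val_eqE /= inordK ?ltn_mod //= mulnC modnMDl modn_small.
Qed.

Theorem theorem7 (n : nat) (hn : 6 <= n) : co_pos_ex n F5 = n %/ 3.
Proof.
apply/eqP; rewrite eqn_leq; apply/andP; split.
  apply/bigmax_leqP => H /andP[H0 F5free].
  by have := F5_free_min_pos_codegree _ H0 F5free; rewrite card_ord; apply.
pose T := tripartite (@residue3 n).
have T0 : edges T != set0.
  have lt0 : 0 < n by lia.
  have lt1 : 1 < n by lia.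
  have lt2 : 2 < n by lia.
  (* The vertices 0, 1, 2 have three different residues. *)
  apply/set0Pn; exists [set Ordinal lt0; Ordinal lt1; Ordinal lt2].
  by rewrite -/(adj T _ _ _) tripartite_adj /= !inE -!val_eqE /= !inordK.
apply: (bigmax_sup T); first by rewrite T0 tripartite_F5_free.
exact: tripartite_min_pos_codegree T0 (@card_residue3 n).
Qed.
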